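(* Suppose that the following assertion (the ''finite'' conjecture) holds: for every elliptical disk $E \subset \mathbb{R}^2$ and every point set $Z \subset \partial E$ such that $\# Z \le 5$ and $E$ has the minimum area among all elliptical disks containing $Z$, the set $R(Z) \cap E$ satisfies the property $T\left(\frac{1+\sqrt5}{2} B\right)$, where $$R(Z) = \{ x \in \mathbb{R}^2 : \{x\} \cup Z \text{ satisfies the property } T(B,3) \}.$$ Then $\lambda(B,3) = \frac{1+\sqrt5}{2}$.
   Context: $B = \{(x,y) \in \mathbb{R}^2 : x^2+y^2 \le 1\}$ is the closed unit disk. For a convex body $K \subset \mathbb{R}^2$, a point set $X \subseteq \mathbb{R}^2$ satisfies the property $T(K)$ if there is a line meeting every translate $K + x$, $x \in X$. For an integer $s>2$, $X$ satisfies the property $T(K,s)$ if every subset of $X$ consisting of at most $s$ elements satisfies the property $T(K)$. The number $\lambda(K,s)$ is the minimum positive $\lambda$ such that every finite point set $X \subset \mathbb{R}^2$ with the property $T(K,s)$ also satisfies the property $T(\lambda K)$. An elliptical disk is the closed region bounded by a (nondegenerate) ellipse in the plane; $\partial E$ is its boundary. *)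

(* Defs.v *)
From HB Require Import structures.
From mathcomp Require Import all_boot all_order all_algebra.
From mathcomp Require Import all_classical all_reals all_analysis.

Set Implicit Arguments.
Unset Strict Implicit.
Unset Printing Implicit Defensive.

Import Order.TTheory GRing.Theory Num.Theory.
Import numFieldNormedType.Exports.

Local Open Scope classical_set_scope.
Local Open Scope card_scope.
Local Open Scope ring_scope.

(* The plane is R * R for R : realType. *)

Section Plane.
Variable R : realType.
Implicit Types (K X Y Z L E : set (R * R)) (l : R) (s : nat).

Definition unit_disk : set (R * R) := [set x | x.1 ^+ 2 + x.2 ^+ 2 <= 1].

Definition is_line L : Prop :=
  exists p d : R * R, d != 0 /\ L = [set p + t *: d | t in [set: R]].

Definition translate K (x : R * R) : set (R * R) := [set k + x | k in K].

Definition dilate l K : set (R * R) := [set l *: k | k in K].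

Definition property_T K X : Prop :=
  exists2 L, is_line L & forall x, X x -> (L `&` translate K x) !=set0.

Definition property_Ts K s X : Prop :=
  forall Y, Y `<=` X -> Y #<= `I_s -> property_T K Y.

Definition admissible_factors K s : set R :=
  [set l | 0 < l /\
    forall X, finite_set X -> property_Ts K s X -> property_T (dilate l K) X].

(* [is_lambda K s m] says that lambda(K, s) = m.  The defining minimum is
   required to be attained, not merely to be an infimum. *)
Definition is_lambda K s (m : R) : Prop :=
  admissible_factors K s m /\ lbound (admissible_factors K s) m.

Definition boundary E : set (R * R) := closure E `\` interior E.

(* c is the centre, u the unit direction of one axis (the other one is
   (- u.2, u.1)), and a, b are the corresponding semi-axes. *)
Definition ellipse_region (c u : R * R) (a b : R) : set (R * R) :=
  [set x | (((x.1 - c.1) * u.1 + (x.2 - c.2) * u.2) / a) ^+ 2 +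
           (((x.2 - c.2) * u.1 - (x.1 - c.1) * u.2) / b) ^+ 2 <= 1].

Definition elliptical_disk E : Prop :=
  exists (c u : R * R) (a b : R),
    [/\ u.1 ^+ 2 + u.2 ^+ 2 = 1, 0 < a, 0 < b & E = ellipse_region c u a b].

Definition area E : \bar R :=
  ((@lebesgue_measure R) \x (@lebesgue_measure R))%E E.

Definition min_area_elliptical_disk E Z : Prop :=
  [/\ elliptical_disk E, Z `<=` E &
    forall E', elliptical_disk E' -> Z `<=` E' -> (area E <= area E')%E].

Definition R_set Z : set (R * R) :=
  [set x | property_Ts unit_disk 3 ([set x] `|` Z)].

Definition golden_ratio : R := (1 + Num.sqrt 5) / 2.

Definition finite_conjecture : Prop :=
  forall E Z, elliptical_disk E -> Z `<=` boundary E -> Z #<= `I_5 ->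
    min_area_elliptical_disk E Z ->
    property_T (dilate golden_ratio unit_disk) (R_set Z `&` E).

End Plane.

Arguments unit_disk R : clear implicits.
Arguments golden_ratio R : clear implicits.
Arguments finite_conjecture R : clear implicits.

(* Main.v *)
Require Import Defs.
From mathcomp Require Import all_boot all_order all_algebra.
From mathcomp Require Import all_classical all_reals all_analysis.
From mathcomp Require Import measurable_realfun ring lra.

(* Upper bound: the smallest-area ellipse E around a finite non-collinear set X
   is determined by at most five points Z of X on its boundary, and X lies in
   R(Z) and in E, so the conjecture applies.  To find Z, write ellipses as
   { |A x + b| <= 1 } with A triangular with positive diagonal: five real
   parameters, for which containing a given point is a convex condition, as is
   det A > m, i.e. having area below a given bound.  When m is the optimal
   determinant these convex sets have no common point, so by Helly's theorem six
   of them have none; one of the six is the determinant condition, and the other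
   five are given by points of X.  Points of X interior to E can be discarded
   beforehand, because a small step towards better parameters keeps them inside.
   Lower bound: in a regular pentagon, every four vertices lie in the strip
   between a side and the parallel diagonal, and the ratio of the width of the
   pentagon to that of this strip is the golden ratio. *)

Set Implicit Arguments.
Unset Strict Implicit.
Unset Printing Implicit Defensive.

Import Order.TTheory GRing.Theory Num.Theory.
Import numFieldNormedType.Exports.

Local Open Scope classical_set_scope.
Local Open Scope card_scope.
Local Open Scope ring_scope.

Lemma card_le_size (T : eqType) (Z : seq T) n :
  (size Z <= n)%N -> [set` Z] #<= `I_n.
Proof.
(* The empty list is set apart because [nth] needs a default, here [z0]. *)
case: Z => [_|z0 Z' Zn]; first by rewrite set_nil; exact: card_ge0.
set Z := z0 :: Z' in Zn *.
apply: card_le_trans (_ : `I_(size Z) #<= _); last by rewrite card_le_II.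
apply: card_le_trans (card_image_le (nth z0 Z) _).
apply: subset_card_le => z /= zZ.
by exists (index z Z); [by move: zZ; rewrite -index_mem|exact: nth_index].
Qed.

(** * Helly's theorem *)

Section Helly.
Variable R : realFieldType.

Lemma convex_setP (V : lmodType R) (C : set V) :
  convex_set C <-> forall (x y : V) (k : R),
    0 <= k -> k <= 1 -> C x -> C y -> C (k *: x + (1 - k) *: y).
Proof.
split=> [cC x y k k0 k1 /mem_set Cx /mem_set Cy|cC x y k Cx Cy].
  have k01 : Itv.spec (@Itv.num_sem R) (Itv.Real `[0%Z, 1%Z]) k.
    by rewrite /Itv.spec /= /Itv.num_sem /= num_real in_itv /= k0 k1.
  exact: set_mem (cC x y (Itv.Def k01) Cx Cy).
by apply: mem_set; apply: cC; rewrite ?ge0 ?le1//; exact: set_mem.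
Qed.

(** The weights are left unnormalised, so that induction on [r] goes through and a total weight of
    zero is allowed; [C !=set0] supplies [y] for the empty sum. *)
Lemma convex_set_sum (V : lmodType R) (C : set V) (I : Type) (r : seq I)
    (P : pred I) (w : I -> R) (x : I -> V) : convex_set C -> C !=set0 ->
    (forall i, P i -> 0 <= w i) -> (forall i, P i -> C (x i)) ->
  exists2 y, C y &
    \sum_(i <- r | P i) w i *: x i = (\sum_(i <- r | P i) w i) *: y.
Proof.
move=> /convex_setP cC [y0 Cy0] w0 Cx.
elim: r => [|i r [y Cy IH]]; first by exists y0; rewrite ?big_nil ?scale0r.
rewrite !big_cons; case: ifPn => [Pi|_]; last by exists y.
have S0 : 0 <= \sum_(j <- r | P j) w j by exact: sumr_ge0.
set S := \sum_(j <- r | P j) w j in IH S0 *; have wi0 := w0 _ Pi.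
have [wS|wS] := eqVneq (w i + S) 0.
  move/eqP: (wS); rewrite paddr_eq0// => /andP[/eqP wi /eqP SE].
  by exists y => //; rewrite IH wi SE addr0 !scale0r addr0.
have wS0 : 0 < w i + S by rewrite lt_neqAle eq_sym wS addr_ge0.
exists (w i / (w i + S) *: x i + (1 - w i / (w i + S)) *: y).
  apply: cC => //; rewrite ?divr_ge0 ?addr_ge0//; last exact: Cx.
  by rewrite ler_pdivrMr// mul1r lerDl.
rewrite IH scalerDr !scalerA; congr (_ *: _ + _ *: _); by field.
Qed.

(** The [n] rows [(x i, 1)] have [d + 1 < n] columns, so some nonzero [l] kills them from the left;
    the column of ones makes the sum of [l] vanish. *)
Lemma affine_dependence d n (x : 'I_n -> 'rV[R]_d) : (d.+1 < n)%N ->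
  exists l : 'I_n -> R, [/\ exists i, l i != 0, \sum_i l i = 0 &
    \sum_i l i *: x i = 0].
Proof.
move=> dn; pose M : 'M[R]_(n, d + 1) := \matrix_i row_mx (x i) 1%:M.
have : kermx M != 0.
  rewrite kermx_eq0 /row_free ltn_eqF//.
  by rewrite (leq_ltn_trans (rank_leq_col _)) // addn1.
case/rowV0Pn => l /sub_kermxP lM0 l0.
have := mulmx_sum_row l M; rewrite lM0 => /esym sum0.
exists (l ord0); split.
- apply/existsP; apply: contraR l0 => /existsPn l0.
  by apply/eqP/rowP => i; rewrite mxE; apply/eqP; move: (l0 i); rewrite negbK.
- have := congr1 (fun v => rsubmx v ord0 ord0) sum0.
  rewrite !mxE summxE => {2}<-; apply: eq_bigr => i _.
  by rewrite !mxE (unsplitK (inr _)) mxE eqxx mulr1.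
- apply/rowP => j; have := congr1 (fun v => lsubmx v ord0 j) sum0.
  rewrite !mxE !summxE => {2}<-; apply: eq_bigr => i _.
  by rewrite !mxE (unsplitK (inl _)).
Qed.

(** Radon's argument: splitting an affine dependence by the sign of [l] writes one point [y] as a
    convex combination of the [x i] on either side. For each [j], the side without [j] consists of
    points of [C j], so [y] is in [C j]. *)
Lemma helly_step d n (C : 'I_n -> set 'rV[R]_d) (x : 'I_n -> 'rV[R]_d) :
    (d.+1 < n)%N -> (forall i, convex_set (C i)) ->
    (forall i j, i != j -> C j (x i)) ->
  exists y, forall j, C j y.
Proof.
move=> /(affine_dependence x)[l [[i0 li0] sum0 sumx0]] cC Cx.
have D (F : 'I_n -> 'rV[R]_d) : \sum_i F i =
    \sum_(i | 0 < l i) F i + \sum_(i | ~~ (0 < l i)) F i.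
  by rewrite (bigID (fun i => 0 < l i)).
pose S := \sum_(i | 0 < l i) l i.
have SN : \sum_(i | ~~ (0 < l i)) - l i = S.
  move: sum0; rewrite (bigID (fun i => 0 < l i))/= => /eqP.
  by rewrite addr_eq0 sumrN => /eqP.
have S0 : 0 < S.
  have Sge0 : 0 <= S by apply: sumr_ge0 => i /ltW.
  rewrite lt_neqAle Sge0 andbT eq_sym; apply: contra li0 => /eqP S0.
  have [l0|l0] := boolP (0 < l i0).
    move/eqP: S0; rewrite /S (bigD1 i0)//= paddr_eq0 ?(ltW l0)//.
      by case/andP.
    by apply: sumr_ge0 => i /andP[/ltW].
  move: SN; rewrite S0 (bigD1 i0)//= => /eqP; rewrite paddr_eq0.
  - by case/andP; rewrite oppr_eq0.
  - by rewrite oppr_ge0 leNgt.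
  - by apply: sumr_ge0 => i /andP[li _]; rewrite oppr_ge0 leNgt.
have yN : \sum_(i | 0 < l i) l i *: x i = \sum_(i | ~~ (0 < l i)) - l i *: x i.
  apply/eqP; rewrite -subr_eq0 -sumrN; apply/eqP; rewrite -[RHS]sumx0 D.
  congr (_ + _).
  by apply: eq_bigr => i _; rewrite scaleNr opprK.
exists (S^-1 *: \sum_(i | 0 < l i) l i *: x i) => j.
have [lj|lj] := boolP (0 < l j).
- rewrite yN; have [] := @convex_set_sum _ (C j) _ (index_enum _)
    (fun i => ~~ (0 < l i)) (fun i => - l i) x (cC j).
  + have [i li] : exists i, ~~ (0 < l i).
      apply/existsP; apply: contraTT S0 => /existsPn lp.
      rewrite -leNgt -SN big_pred0// => i; have := lp i; by case: (0 < l i).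
    by exists (x i); apply: Cx; apply: contraNneq li => ->.
  + by move=> i li; rewrite oppr_ge0 leNgt.
  + by move=> i li; apply: Cx; apply: contraNneq li => ->.
  move=> y Cy ->; rewrite SN scalerA mulVf ?scale1r//; exact: lt0r_neq0.
- have [] := @convex_set_sum _ (C j) _ (index_enum _)
    (fun i => 0 < l i) l x (cC j).
  + have [i li] : exists i, 0 < l i.
      apply/existsP; apply: contraTT S0 => /existsPn lp.
      rewrite -leNgt /S big_pred0// => i; exact/negbTE/lp.
    by exists (x i); apply: Cx; apply: contraTneq li => ->.
  + by move=> i /ltW.
  + by move=> i li; apply: Cx; apply: contraTneq li => ->.
  move=> y Cy ->; rewrite -/S scalerA mulVf ?scale1r//; exact: lt0r_neq0.
Qed.

(** Induction on the size of [s]: dropping the [i]-th entry leaves a family with a common point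
    [x i], and [helly_step] combines these points. Positions rather than entries are dropped, so
    repetitions in [s] are harmless. *)
Lemma helly (T : eqType) d (C : T -> set 'rV[R]_d) (s : seq T) :
    (forall t, t \in s -> convex_set (C t)) ->
    (forall u : seq T, {subset u <= s} -> (size u <= d.+1)%N ->
      exists y, forall t, t \in u -> C t y) ->
  exists y, forall t, t \in s -> C t y.
Proof.
have [n] := ubnP (size s); elim: n => // n IH in s *; rewrite ltnS => sn cC Cs.
have [|ds] := leqP (size s) d.+1; first exact: Cs.
have [t0 _] : exists t0 : T, True by case: (s) ds => // t; exists t.
pose s' (i : 'I_(size s)) := take i s ++ drop i.+1 s.
have s's i : {subset s' i <= s}.
  by move=> t; rewrite mem_cat => /orP[/mem_take|/mem_drop].
have /choice[x xP] (i : 'I_(size s)) : exists y, forall t, t \in s' i -> C t y.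
  apply: IH => [|t /s's|u us']; first last.
  - by apply: Cs => t /us' /s's.
  - exact: cC.
  - apply: leq_trans sn; rewrite size_cat size_drop size_takel;
      last exact: ltnW.
    by rewrite -addSn subnKC.
have [i|i j ij|y yP] := @helly_step _ _ (fun i => C (nth t0 s i)) x ds.
- by apply: cC; exact: mem_nth.
- apply: xP; rewrite mem_cat.
  have [ji|ij'] := ltnP j i.
    by rewrite -(nth_take _ ji) mem_nth// size_takel// ltnW.
  have {}ij : (i < j)%N by rewrite ltn_neqAle ij.
  rewrite -(subnKC ij) -nth_drop mem_nth ?orbT// size_drop.
  by rewrite ltn_sub2r// (leq_ltn_trans ij).
- by exists y => t ts; have := yP (Ordinal (_ : index t s < size s)%N);
    rewrite /= nth_index// index_mem => /(_ ts).
Qed.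

End Helly.

(** * Strips and the regular pentagon *)

Section Strips.
Variable R : realType.
Implicit Types (X Y K : set (R * R)) (l : R).

Lemma property_T_subset K X Y : X `<=` Y -> property_T K Y -> property_T K X.
Proof. by move=> XY [L ? LY]; exists L => // x /XY; exact: LY. Qed.

Lemma property_Ts_subset K s X Y :
  X `<=` Y -> property_Ts K s Y -> property_Ts K s X.
Proof. by move=> XY TY Z ZX; apply: TY; exact: subset_trans XY. Qed.

Lemma dilate1 K : dilate 1 K = K.
Proof.
apply/seteqP; split=> [_ [x Kx <-]|x Kx]; first by rewrite scale1r.
by exists x; rewrite ?scale1r.
Qed.

(** A line meets the disk of radius [l] about [x] exactly when [x] is at distance at most [l] from
    it. The normal [n] is not normalised and the distance is squared, which keeps everything
    polynomial. *)
Lemma property_T_strip l X : 0 < l -> property_T (dilate l (unit_disk R)) X <->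
  exists (n : R * R) (c : R), 0 < n.1 ^+ 2 + n.2 ^+ 2 /\ forall x, X x ->
    (n.1 * x.1 + n.2 * x.2 - c) ^+ 2 <= l ^+ 2 * (n.1 ^+ 2 + n.2 ^+ 2).
Proof.
move=> l0; split.
- move=> [_ [p [d [d0 ->]]] pX].
  exists (- d.2, d.1), (- d.2 * p.1 + d.1 * p.2) => /=; split.
    rewrite sqrrN lt_neqAle addr_ge0 ?sqr_ge0// andbT eq_sym.
    rewrite paddr_eq0 ?sqr_ge0// !sqrf_eq0 andbC.
    by apply: contra d0; case: d {pX} => /= d1 d2; rewrite -pair_eqE.
  move=> x /pX [_ [[t _ <-]] [_ [k Bk <-]]].
  case: x k p d {d0 pX} Bk => x1 x2 [k1 k2] [p1 p2] [d1 d2].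
  rewrite /unit_disk /= => Bk [].
  rewrite /GRing.scale /= => e1 e2.
  have -> : x1 = p1 + t * d1 - l * k1 by rewrite -e1; ring.
  have -> : x2 = p2 + t * d2 - l * k2 by rewrite -e2; ring.
  rewrite (_ : _ ^+ 2 = l ^+ 2 * (d1 * k2 - d2 * k1) ^+ 2); last by ring.
  apply: ler_wpM2l; first exact: sqr_ge0.
  (* Lagrange's identity: this square and that of [d1 * k2 - d2 * k1] add up to the product of the
     squared lengths of [d] and [k]. *)
  have := sqr_ge0 (d1 * k1 + d2 * k2).
  have : 0 <= (1 - (k1 ^+ 2 + k2 ^+ 2)) * (d1 ^+ 2 + d2 ^+ 2).
    by rewrite mulr_ge0 ?subr_ge0 ?addr_ge0 ?sqr_ge0.
  lra.
- move=> [[n1 n2] [c [/= N0 nX]]].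
  set N := n1 ^+ 2 + n2 ^+ 2 in N0 nX; have NN : N != 0 by rewrite gt_eqF.
  exists [set (c / N * n1, c / N * n2) + t *: (- n2, n1) | t in [set: R]].
    exists (c / N * n1, c / N * n2), (- n2, n1); split=> //.
    apply: contraTneq N0 => -[/eqP]; rewrite oppr_eq0 => /eqP n20 n10.
    by rewrite /N n10 n20 expr0n addr0 ltxx.
  move=> [x1 x2] /nX /=; set u := n1 * x1 + n2 * x2 - c => uN.
  (* The foot of the perpendicular from [x] to the line. *)
  exists (x1 - u / N * n1, x2 - u / N * n2); split.
    exists ((n1 * x2 - n2 * x1) / N) => //.
    by congr pair; rewrite /= /GRing.scale /= /u /N; field.
  exists (- (u / N) *: (n1, n2)).
    exists (- (u / (l * N)) *: (n1, n2)); rewrite /unit_disk /=.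
      rewrite /GRing.scale /= (_ : _ + _ = u ^+ 2 / (l ^+ 2 * N)); last first.
        by rewrite /N; field; rewrite -/N NN gt_eqF.
      by rewrite ler_pdivrMr ?mul1r// mulr_gt0 ?exprn_gt0.
    by congr pair; rewrite /= /GRing.scale /=; field; rewrite NN gt_eqF.
  by congr pair; rewrite /= /GRing.scale /=; ring.
Qed.

(** Twice the signed area of the triangle [abc]; it vanishes exactly on collinear triples. *)
Definition cross (a b c : R * R) : R :=
  (b.1 - a.1) * (c.2 - a.2) - (c.1 - a.1) * (b.2 - a.2).

(** This settles the flat sets, around which ellipses have arbitrarily small area and no smallest
    one exists. *)
Lemma property_T_collinear l (X : set (R * R)) : 0 < l ->
  (forall a b c, X a -> X b -> X c -> cross a b c = 0) ->
  property_T (dilate l (unit_disk R)) X.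
Proof.
move=> l0 X0; apply/property_T_strip => //.
have [[a [b [Xa Xb ab]]]|noab] := pselect (exists a b, [/\ X a, X b & a != b]).
- exists (a.2 - b.2, b.1 - a.1), ((a.2 - b.2) * a.1 + (b.1 - a.1) * a.2) => /=.
  have n0 : 0 < (a.2 - b.2) ^+ 2 + (b.1 - a.1) ^+ 2.
    rewrite lt_neqAle addr_ge0 ?sqr_ge0// andbT eq_sym paddr_eq0 ?sqr_ge0//.
    rewrite !sqrf_eq0 !subr_eq0; apply: contra ab => /andP[/eqP h1 /eqP h2].
    by rewrite -pair_eqE /pair_eq /= h1 h2 !eqxx.
  split=> // x Xx; have := X0 _ _ _ Xa Xb Xx; rewrite /cross => abx.
  rewrite (_ : _ - _ = 0) ?expr0n ?mulr_ge0 ?sqr_ge0 ?(ltW n0)//; lra.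
- have [[a Xa]|noa] := pselect (exists a, X a).
    exists (1, 0), a.1 => /=; rewrite expr1n expr0n addr0; split=> // x Xx.
    have -> : x = a.
      by apply: contrapT => /eqP xa; apply: noab; exists x, a.
    by rewrite mul0r mul1r addr0 subrr expr0n mulr1 sqr_ge0.
  exists (1, 0), 0 => /=; rewrite expr1n expr0n addr0; split=> // x Xx.
  by exfalso; apply: noa; exists x.
Qed.

End Strips.

Section Pentagon.
Variable R : realType.
Let phi : R := golden_ratio R.
Let sig : R := Num.sqrt ((12 - 4 * phi) / 5).

Lemma golden_ratio_sqr : golden_ratio R ^+ 2 = golden_ratio R + 1.
Proof.
have := @sqr_sqrtr R 5 (ler0n _ _); rewrite /golden_ratio; set s := Num.sqrt 5.
by move=> s5; rewrite expr_div_n sqrrD s5; field.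
Qed.

Lemma golden_ratio_bounds : 3 / 2 < golden_ratio R < 2.
Proof.
have := @sqr_sqrtr R 5 (ler0n _ _); rewrite /golden_ratio.
have := sqrtr_ge0 (5 : R); set s := Num.sqrt 5 => s0 s5.
by apply/andP; split; nra.
Qed.

Let phiE : phi ^+ 2 = phi + 1. Proof. exact: golden_ratio_sqr. Qed.
Let phi1 : 3 / 2 < phi. Proof. by case/andP: golden_ratio_bounds. Qed.
Let phi2 : phi < 2. Proof. by case/andP: golden_ratio_bounds. Qed.

Let sigE : sig ^+ 2 = (12 - 4 * phi) / 5.
Proof. by rewrite sqr_sqrtr//; move: phi2; lra. Qed.
Let sig0 : 0 < sig. Proof. by rewrite sqrtr_gt0; move: phi2; lra. Qed.

Let base : seq (R * R) :=
  [:: (phi * sig, 1); (sig, -1); (- sig, -1); (- (phi * sig), 1)].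

(* The regular pentagon of height 2 * phi, with sides at distance 2 from the
   parallel diagonals; sig is 1 / sin 72 in degrees. *)
Let pentagon : seq (R * R) := (0, 2 * phi - 1) :: base.

Lemma base_uniq : uniq base.
Proof.
rewrite /base /= !inE !xpair_eqE !negb_or.
have ps : 0 < phi * sig by apply: mulr_gt0 => //; move: phi1; lra.
have s0 := sig0; rewrite !andbT -!andbA; apply/and5P; split;
  try (apply/andP; split); by apply/negP => /andP[/eqP h1 /eqP h2]; lra.
Qed.

(** The strip lies between the side opposite to [q] and the diagonal parallel to it. All four
    remaining vertices are on its two boundary lines, hence the equality in [nc]. *)
Lemma pentagon_strip (q : R * R) : q \in base ->
  property_T (unit_disk R) [set x | x \in pentagon /\ x != q].
Proof.
(* [lra] treats monomials as atoms, so the required multiples of [phi ^+ 2 = phi + 1] are supplied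
   by hand. *)
have e1 := phiE; have e2 := sigE.
have e3 : phi ^+ 3 = 2 * phi + 1 by rewrite exprS e1 mulrDr -expr2 e1; ring.
have e4 : phi ^+ 2 * sig = phi * sig + sig by rewrite e1; ring.
move=> qb; rewrite -[unit_disk R]dilate1; apply/property_T_strip => //.
have N0 : 0 < 4 * sig ^+ 2 by rewrite mulr_gt0 ?exprn_gt0.
have [n [c [nE nc]]] : exists (n : R * R) (c : R),
  n.1 ^+ 2 + n.2 ^+ 2 = 4 * sig ^+ 2 /\ forall x, x \in pentagon -> x != q ->
   (n.1 * x.1 + n.2 * x.2 - c) ^+ 2 = 4 * sig ^+ 2; last first.
  exists n, c; rewrite nE; split=> // x [xp xq].
  by rewrite expr1n mul1r nc.
have h1 : 2 ^+ 2 + ((phi - 1) * sig) ^+ 2 = 4 * sig ^+ 2.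
  rewrite exprMn sigE; lra.
have h2 : (2 * (phi - 1)) ^+ 2 + (phi * sig) ^+ 2 = 4 * sig ^+ 2.
  by rewrite [(phi * sig) ^+ 2]exprMn sigE; lra.
have sq (a : R) : (a = 2 * sig \/ a = - (2 * sig)) -> a ^+ 2 = 4 * sig ^+ 2.
  by case=> ->; ring.
move: qb; rewrite !inE => /or4P[] /eqP ->.
- exists (2, (phi - 1) * sig), ((1 - phi) * sig); rewrite /= h1; split=> // x.
  rewrite !inE => /or4P[/eqP ->|/eqP ->|/eqP ->|/orP[]/eqP ->];
    rewrite ?eqxx//= => _; apply: sq; by [left; lra|right; lra].
- exists (2 * (phi - 1), - (phi * sig)), (- (phi * sig)); rewrite /= sqrrN h2;
    split=> // x.
  rewrite !inE => /or4P[/eqP ->|/eqP ->|/eqP ->|/orP[]/eqP ->];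
    rewrite ?eqxx//= => _; apply: sq; by [left; lra|right; lra].
- exists (- (2 * (phi - 1)), - (phi * sig)), (- (phi * sig));
    rewrite /= !sqrrN h2; split=> // x.
  rewrite !inE => /or4P[/eqP ->|/eqP ->|/eqP ->|/orP[]/eqP ->];
    rewrite ?eqxx//= => _; apply: sq; by [left; lra|right; lra].
- exists (-2, (phi - 1) * sig), ((1 - phi) * sig); rewrite /= sqrrN h1;
    split=> // x.
  rewrite !inE => /or4P[/eqP ->|/eqP ->|/eqP ->|/orP[]/eqP ->];
    rewrite ?eqxx//= => _; apply: sq; by [left; lra|right; lra].
Qed.

(** Pigeonhole: at most three points miss one of the four vertices in [base]. *)
Lemma pentagon_Ts : property_Ts (unit_disk R) 3 [set` pentagon].
Proof.
move=> Y Yp Y3.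
have [q qb Yq] : exists2 q, q \in base & ~ Y q.
  apply: contrapT => noq.
  have bY : nth 0 base @` `I_4 `<=` Y.
    move=> _ [i i4 <-]; apply: contrapT => Yi; apply: noq.
    by exists (nth 0 base i) => //; rewrite mem_nth.
  have inj : {in `I_4 &, injective (nth 0 base)}.
    move=> i j; rewrite !inE /= => i4 j4 /eqP.
    by rewrite nth_uniq ?base_uniq// => /eqP.
  have := card_le_trans (subset_card_le bY) Y3.
  by rewrite (card_le_eql (inj_card_eq inj)) card_le_II.
apply: property_T_subset (pentagon_strip qb) => y Yy; split; first exact: Yp.
by apply/eqP => yq; apply: Yq; rewrite -yq.
Qed.

(** If [l < phi], any two vertices differ along [n] by less than [2 * phi] times the length of [n].
    Applied to the five diagonals, one horizontal and two mirror pairs, this leaves no possible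
    direction for [n]. *)
Lemma pentagon_width l : 0 < l ->
  property_T (dilate l (unit_disk R)) [set` pentagon] -> phi <= l.
Proof.
move=> l0 /(property_T_strip _ l0)[[n1 n2] [c [/= N0 nX]]].
rewrite leNgt; apply/negP => lphi.
set N := n1 ^+ 2 + n2 ^+ 2 in N0 nX.
have lN : l ^+ 2 * N < phi ^+ 2 * N.
  by rewrite ltr_pM2r// ltr_pXn2r// nnegrE ltW// (lt_trans l0).
have diff (x y : R * R) : x \in pentagon -> y \in pentagon ->
    (n1 * (x.1 - y.1) + n2 * (x.2 - y.2)) ^+ 2 < 4 * (phi ^+ 2 * N).
  move=> /nX hx /nX hy.
  apply: le_lt_trans (_ : 4 * (l ^+ 2 * N) < _); last by rewrite ltr_pM2l.
  move: hx hy; set u := _ - c; set v := _ - c => hx hy.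
  rewrite (_ : _ + _ = u - v); last by rewrite /u /v; ring.
  by have := sqr_ge0 (u + v); lra.
pose a := `|n1|; pose b := `|n2|.
have a2 : n1 ^+ 2 = a ^+ 2 by rewrite real_normK ?num_real.
have b2 : n2 ^+ 2 = b ^+ 2 by rewrite real_normK ?num_real.
have a0 : 0 <= a by exact: normr_ge0.
have b0 : 0 <= b by exact: normr_ge0.
(* For a diagonal and its mirror image, one of the two cross terms carries [n1 * n2] with the sign
   that turns it into [a * b]. *)
have diag (x y : R) : (n1 * x + n2 * y) ^+ 2 < 4 * (phi ^+ 2 * N) ->
    (n1 * - x + n2 * y) ^+ 2 < 4 * (phi ^+ 2 * N) ->
    x ^+ 2 * a ^+ 2 + 2 * x * y * (a * b) + y ^+ 2 * b ^+ 2 <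
    4 * (phi ^+ 2 * (a ^+ 2 + b ^+ 2)).
  rewrite -a2 -b2 -/N => h1 h2.
  have [e|e] : a * b = n1 * n2 \/ a * b = - (n1 * n2).
  - by rewrite /a /b -normrM; case: (ger0P (n1 * n2)) => _; [left|right].
  - by rewrite e; move: h1; congr (_ < _); ring.
  - by rewrite e; move: h2; congr (_ < _); ring.
have e1 := phiE; have e2 := sigE.
have hA : sig ^+ 2 * a ^+ 2 < a ^+ 2 + b ^+ 2.
  have := @diff (phi * sig, 1) (- (phi * sig), 1); rewrite !inE !eqxx !orbT /=.
  move=> /(_ isT isT); rewrite /N a2 b2.
  rewrite (_ : (_ + _) ^+ 2 = 4 * (phi ^+ 2 * (sig ^+ 2 * n1 ^+ 2)));
    last by ring.
  by rewrite a2 !ltr_pM2l// exprn_gt0//; move: phi1; lra.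
have hB : sig ^+ 2 * a ^+ 2 + 2 * sig * (2 * phi) * (a * b) +
    (2 * phi) ^+ 2 * b ^+ 2 < 4 * (phi ^+ 2 * (a ^+ 2 + b ^+ 2)).
  apply: diag.
    have := @diff (0, 2 * phi - 1) (- sig, -1); rewrite !inE !eqxx !orbT /=.
    by move=> /(_ isT isT); congr (_ < _); ring.
  have := @diff (0, 2 * phi - 1) (sig, -1); rewrite !inE !eqxx !orbT /=.
  by move=> /(_ isT isT); congr (_ < _); ring.
have hC : ((phi + 1) * sig) ^+ 2 * a ^+ 2 +
    2 * ((phi + 1) * sig) * 2 * (a * b) +
    2 ^+ 2 * b ^+ 2 < 4 * (phi ^+ 2 * (a ^+ 2 + b ^+ 2)).
  apply: diag.
    have := @diff (phi * sig, 1) (- sig, -1); rewrite !inE !eqxx !orbT /=.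
    by move=> /(_ isT isT); congr (_ < _); ring.
  have := @diff (- (phi * sig), 1) (sig, -1); rewrite !inE !eqxx !orbT /=.
  by move=> /(_ isT isT); congr (_ < _); ring.
have s0 := sig0; have p1 := phi1.
(* t1 and t2 are the tangents of 18 and 54 degrees: hA, hB and hC exclude the
   slopes b / a below t1, above t2, and between them. *)
pose t1 := (phi - 1) * sig / 2; pose t2 := (phi + 1) * sig / 2.
have t1a : t1 * a < b.
  rewrite ltNge; apply/negP => ba.
  have : b ^+ 2 <= (t1 * a) ^+ 2 by rewrite ler_pXn2r// nnegrE// (le_trans b0).
  have -> : (t1 * a) ^+ 2 = (sig ^+ 2 - 1) * a ^+ 2.
    rewrite -(_ : (phi ^+ 2 - 2 * phi + 1) * sig ^+ 2 / 4 =
      sig ^+ 2 - 1) ?/t1; first by field.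
    rewrite e1 e2; lra.
  by lra.
have bt2 : b < t2 * a.
  have : 0 < (4 * phi * sig) * (a * (t2 * a - b)).
    rewrite (_ : _ * _ =
      ((24 * phi + 8) / 5) * a ^+ 2 - 4 * phi * sig * (a * b)).
      move: hB; rewrite exprMn e1 e2; lra.
    rewrite (_ : (24 * phi + 8) / 5 = 2 * (phi ^+ 2 + phi) * sig ^+ 2);
      first by rewrite /t2; field.
    rewrite e2 e1; lra.
  rewrite pmulr_rgt0; last by rewrite mulr_gt0// mulr_gt0//; lra.
  move=> h; rewrite -subr_gt0; apply: contraTT h; rewrite -!leNgt => h.
  exact: mulr_ge0_le0.
have : 0 < (b - t1 * a) * (t2 * a - b) by rewrite mulr_gt0// subr_gt0.
have : 0 < (4 * phi) * ((b - t1 * a) * (b - t2 * a)); last first.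
  rewrite pmulr_rgt0; last by lra.
  lra.
have e3 : phi ^+ 3 = 2 * phi + 1 by rewrite exprS e1 mulrDr -expr2 e1; ring.
(* The quadratic form with roots [t1] and [t2] in [b / a] is, modulo the relations for [phi] and
   [sig], the difference of the two sides of [hC]. *)
have -> : 4 * phi * ((b - t1 * a) * (b - t2 * a)) =
    4 * phi * b ^+ 2 - 4 * (phi ^+ 2 * sig) * (a * b) +
    (phi ^+ 2 - 1) * phi * sig ^+ 2 * a ^+ 2 by rewrite /t1 /t2; field.
have -> : 4 * phi = 4 * phi ^+ 2 - 4 by lra.
have -> : (phi ^+ 2 - 1) * phi * sig ^+ 2 =
    4 * phi ^+ 2 - (phi + 1) ^+ 2 * sig ^+ 2 by rewrite e1 e2; lra.
have -> : phi ^+ 2 * sig = (phi + 1) * sig by rewrite e1.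
by move: hC; lra.
Qed.

End Pentagon.

(** * Ellipses and their area *)

Section Area.
Variable R : realType.

(** The preimage of the unit disk under an affine map with lower triangular linear part. The first
    coordinate involves only [x.1], so vertical sections are explicit intervals. *)
Definition triangular_ellipse (p s q r t : R) : set (R * R) :=
  [set x | (p * x.1 + s) ^+ 2 + (q * x.1 + r * x.2 + t) ^+ 2 <= 1].

Lemma xsection_triangular_ellipse p s q r t x : 0 < r ->
  lebesgue_measure (xsection (triangular_ellipse p s q r t) x) =
  (2 * Num.sqrt (1 - (p * x + s) ^+ 2) / r)%:E.
Proof.
move=> r0; set D := 1 - (p * x + s) ^+ 2; set w := Num.sqrt D.
have w0 : 0 <= w by exact: sqrtr_ge0.
have [D0|D0] := leP 0 D; last first.
  (* Outside the shadow of the ellipse the section is empty, in accordance with [Num.sqrt] being 0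
     on negative numbers. *)
  rewrite /w ltr0_sqrtr// mulr0 mul0r (_ : xsection _ _ = set0) ?measure0//.
  rewrite -subset0 => y; rewrite /xsection /= inE /triangular_ellipse /=.
  have := sqr_ge0 (q * x + r * y + t); move: D0; rewrite /D; lra.
rewrite (_ : xsection _ _ =
    `[(- w - q * x - t) / r, (w - q * x - t) / r]%classic).
  rewrite lebesgue_measure_itv /= lte_fin ltr_pM2r ?invr_gt0//.
  have [ww|ww] := ltP.
    by rewrite -EFinB -mulrBl; congr ((_ / _)%:E); ring.
  by rewrite (_ : w = 0) ?mulr0 ?mul0r//; lra.
apply/seteqP; split=> y;
  rewrite /xsection /= inE /triangular_ellipse /= in_itv /=;
  rewrite ler_pdivlMr// ler_pdivrMr//.
- move=> h; have : `|q * x + r * y + t| <= w.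
    by rewrite -sqrtr_sqr ler_wsqrtr// /D; lra.
  by rewrite ler_norml => /andP[]; lra.
- move=> /andP[h1 h2]; have : `|q * x + r * y + t| <= w.
    by rewrite ler_norml; apply/andP; split; lra.
  rewrite -(ler_pXn2r (n := 2)) ?nnegrE// sqr_sqrtr// real_normK ?num_real//.
  by rewrite /D; lra.
Qed.

(** Integrate the section lengths and substitute [p * x + s]. The remaining integral, the area of
    the unit disk, stays unevaluated: as a common nonnegative factor it suffices for comparing
    areas. *)
Lemma area_triangular_ellipse p s q r t : 0 < p -> 0 < r ->
  area (triangular_ellipse p s q r t) = ((p * r)^-1%:E *
    \int[@lebesgue_measure R]_x (2 * Num.sqrt (1 - x ^+ 2))%:E)%E.
Proof.
move=> p0 r0; pose F (x : R) : R := p * x + s.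
pose G (x : R) : R := 2 * Num.sqrt (1 - x ^+ 2).
have dF (x : R) : is_derive x (1 : R) F p.
  rewrite /F; apply: is_derive_eq.
  by rewrite addr0 /GRing.scale/= mulr1.
have dFE : derive1 F = cst p by apply/funext => x; rewrite derive1E derive_val.
have cG : continuous G.
  move=> x; apply: cvgM; first exact: cvg_cst.
  apply: (@cvg_comp _ _ _ (fun y : R => 1 - y ^+ 2) Num.sqrt);
    last exact: sqrt_continuous.
  by apply: cvgB; [exact: cvg_cst|exact: exprn_continuous].
have G0 x : 0 <= G x by rewrite mulr_ge0 ?sqrtr_ge0.
rewrite (@increasing_ge0_integration_by_substitutionT _ F G) //; last first.
- by apply: cvg_comp (cvg_addrr s); apply: gt0_cvgMry => //; exact: cvg_id.
- by apply: cvg_comp (cvg_addrr_Ny s); apply: gt0_cvgMrNy => //; exact: cvg_id.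
- by rewrite dFE; exact: is_cvg_cst.
- by rewrite dFE; exact: is_cvg_cst.
- by rewrite dFE => x; exact: cst_continuous.
- by move=> x y xy; rewrite /F ltrD2r ltr_pM2l.
rewrite dFE -ge0_integralZl_EFin//; last 3 first.
- by move=> x _; rewrite lee_fin; apply: mulr_ge0; [exact: G0|exact: ltW].
- apply/measurable_EFinP; apply: measurable_funM => //.
  apply: continuous_measurable_fun => x; apply: continuous_comp; last exact: cG.
  by apply/differentiable_continuous/derivable1_diffP; exact: ex_derive.
- by rewrite invr_ge0 mulr_ge0 ?ltW.
apply: eq_integral => x _; rewrite /= xsection_triangular_ellipse//.
rewrite -EFinM; congr EFin; rewrite /G /F fctE/=; field.
by rewrite !lt0r_neq0.
Qed.

End Area.

(** * Principal axes and triangular form of an ellipse *)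

Section EllipseNormalForm.
Variable R : realType.

(** The spectral theorem for a positive definite symmetric 2 by 2 matrix: [l] and [m] are the
    eigenvalues, and [(b, l - a)] is an eigenvector for [l]. It may vanish when [b = 0], so that
    case comes first. *)
Lemma quadratic_form_diag (a b c : R) : 0 < a -> 0 < a * c - b ^+ 2 ->
  exists (u : R * R) (l m : R), [/\ u.1 ^+ 2 + u.2 ^+ 2 = 1, 0 < l, 0 < m &
    forall x y, a * x ^+ 2 + 2 * b * x * y + c * y ^+ 2 =
      l * (x * u.1 + y * u.2) ^+ 2 + m * (y * u.1 - x * u.2) ^+ 2].
Proof.
move=> a0 D0.
have c0 : 0 < c by rewrite -(pmulr_rgt0 _ a0); have := sqr_ge0 b; lra.
have [->|b0] := eqVneq b 0.
  exists (1, 0), a, c; split=> //=; first by rewrite expr1n expr0n addr0.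
  by move=> x y; ring.
have b2 : 0 < b ^+ 2 by rewrite lt_neqAle sqr_ge0 eq_sym sqrf_eq0 b0.
pose d := Num.sqrt ((a - c) ^+ 2 + 4 * b ^+ 2).
have d2 : d ^+ 2 = (a - c) ^+ 2 + 4 * b ^+ 2.
  by rewrite sqr_sqrtr//; have := sqr_ge0 (a - c); lra.
have d0 : 0 <= d by exact: sqrtr_ge0.
pose l := (a + c + d) / 2; pose m := (a + c - d) / 2.
have l0 : 0 < l by rewrite /l; lra.
have lm : l * m = a * c - b ^+ 2.
  transitivity (((a + c) ^+ 2 - d ^+ 2) / 4); first by rewrite /l /m; field.
  by rewrite d2; field.
have m0 : 0 < m by rewrite -(pmulr_rgt0 _ l0) lm.
pose N := b ^+ 2 + (l - a) ^+ 2.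
have N0 : 0 < N by have := sqr_ge0 (l - a); rewrite /N; lra.
have Nn : N != 0 by rewrite gt_eqF.
pose n := Num.sqrt N.
have n2 : n ^+ 2 = N by rewrite sqr_sqrtr// ltW.
have n0 : n != 0 by rewrite -sqrf_eq0 n2.
have mE : m = a + c - l by rewrite /m /l; field.
have lE : (l - a) * (l - c) = b ^+ 2.
  by have := lm; rewrite mE; lra.
exists (b / n, (l - a) / n), l, m; split=> //=.
  by rewrite !expr_div_n n2 -mulrDl mulfV.
move=> x y.
rewrite (_ : _ + m * _ = (l * (x * b + y * (l - a)) ^+ 2 +
    m * (y * b - x * (l - a)) ^+ 2) / N); last by rewrite -n2; field.
apply: (mulIf Nn); rewrite divfK// /N mE.
(* The two sides differ by a multiple of the characteristic equation [lE], with this cofactor. *)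
have := congr1 (fun z => z * ((l - a) * (y ^+ 2 - x ^+ 2) + 2 * b * x * y)) lE.
by lra.
Qed.

Lemma elliptical_disk_triangular (p s q r t : R) : 0 < p -> 0 < r ->
  elliptical_disk (triangular_ellipse p s q r t).
Proof.
move=> p0 r0.
have [||u [l [m [u1 l0 m0 lmE]]]] :=
    @quadratic_form_diag (p ^+ 2 + q ^+ 2) (q * r) (r ^+ 2).
- by rewrite ltr_wpDr ?sqr_ge0 ?exprn_gt0.
- rewrite (_ : _ - _ = (p * r) ^+ 2); last by ring.
  by rewrite exprn_gt0 ?mulr_gt0.
pose c1 := - s / p; pose c2 := - (q * c1 + t) / r.
exists (c1, c2), u, (Num.sqrt l)^-1, (Num.sqrt m)^-1.
split; rewrite ?invr_gt0 ?sqrtr_gt0//.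
apply/seteqP; split=> [[x y]|[x y]];
  rewrite /triangular_ellipse /ellipse_region /= !invrK !exprMn;
  rewrite !sqr_sqrtr ?(ltW l0) ?(ltW m0)// ![_ ^+ 2 * _]mulrC -lmE;
  congr (_ <= _); rewrite /c2 /c1; field; by rewrite !gt_eqF.
Qed.

(** The forward direction is a Cholesky factorisation: [r ^+ 2] is the coefficient [N] of [y ^+ 2]
    in the quadratic form, [q * r] half that of [x * y], and [p * r] the square root of its
    determinant. *)
Lemma elliptical_diskP E : elliptical_disk E <-> exists (p s q r t : R),
  [/\ 0 < p, 0 < r & E = triangular_ellipse p s q r t].
Proof.
split=> [|[p [s [q [r [t [p0 r0 ->]]]]]]];
  last exact: elliptical_disk_triangular.
move=> [[c1 c2] [[u1 u2] [a [b [/= u a0 b0 ->]]]]].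
have a00 : a != 0 by rewrite gt_eqF.
have b00 : b != 0 by rewrite gt_eqF.
pose N := (u2 / a) ^+ 2 + (u1 / b) ^+ 2.
have N0 : 0 < N.
  rewrite lt_neqAle addr_ge0 ?sqr_ge0// andbT eq_sym paddr_eq0 ?sqr_ge0//.
  rewrite !sqrf_eq0 !mulf_eq0 !invr_eq0 (negbTE a00) (negbTE b00) !orbF.
  apply/negP => /andP[/eqP u20 /eqP u10]; move: u.
  by rewrite u20 u10 expr0n addr0 => /eqP; rewrite eq_sym oner_eq0.
pose r := Num.sqrt N.
have r0 : 0 < r by rewrite sqrtr_gt0.
have r2 : r ^+ 2 = N by rewrite sqr_sqrtr// ltW.
have r00 : r != 0 by rewrite gt_eqF.
pose p := (a * b * r)^-1; pose q := u1 * u2 * ((a ^- 2) - (b ^- 2)) / r.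
exists p, (- (p * c1)), q, r, (- (q * c1 + r * c2)); split=> //.
  by rewrite invr_gt0 !mulr_gt0.
rewrite /ellipse_region /triangular_ellipse; apply/funext => -[x y] /=.
congr (is_true (_ <= _)).
(* The triangular coordinates arise from [(U, V)] by a rotation with entries [u1 / b] and [u2 / a]
   over [r], up to sign, so the sum of squares is unchanged. *)
set U := (_ / a); set V := (_ / b).
have -> : p * x - p * c1 = (u1 / b * U - u2 / a * V) / r.
  transitivity ((u1 ^+ 2 + u2 ^+ 2) * (p * (x - c1))); first by rewrite u; ring.
  by rewrite /p /U /V; field; rewrite a00 b00 r00.
have -> : q * x + r * y - (q * c1 + r * c2) = (u2 / a * U + u1 / b * V) / r.
  transitivity (q * (x - c1) + N / r * (y - c2)).
    by rewrite -r2; field.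
  by rewrite /q /N /U /V; field; rewrite a00 b00 r00.
rewrite !(expr_div_n _ r) r2 -mulrDl.
apply: (mulIf (lt0r_neq0 N0)); rewrite divfK ?lt0r_neq0// /N.
by field; rewrite a00 b00.
Qed.

End EllipseNormalForm.

(** * The smallest-area ellipse *)

Section LoewnerEllipse.
Variable R : realType.
Implicit Types (v w : 'rV[R]_5) (x : R * R) (X : seq (R * R)).

(* v encodes the parameters (p, s, q, r, t) of triangular_ellipse. *)
Definition coef v (i : nat) : R := v ord0 (inord i).

Definition coef_pack (p s q r t : R) : 'rV[R]_5 :=
  \row_(i < 5) nth 0 [:: p; s; q; r; t] i.

Definition gauge v x : R :=
  (coef v 0 * x.1 + coef v 1) ^+ 2 +
  (coef v 2 * x.1 + coef v 3 * x.2 + coef v 4) ^+ 2.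

Definition coef_det v : R := coef v 0 * coef v 3.

Definition coef_pos v := 0 < coef v 0 /\ 0 < coef v 3.

Definition contains v X := forall x, x \in X -> gauge v x <= 1.

Lemma coef_packE (p s q r t : R) (i : nat) : (i < 5)%N ->
  coef (coef_pack p s q r t) i = nth 0 [:: p; s; q; r; t] i.
Proof. by move=> i5; rewrite /coef mxE inordK. Qed.

Lemma coef_conv v w (k : R) i :
  coef (k *: v + (1 - k) *: w) i = k * coef v i + (1 - k) * coef w i.
Proof. by rewrite /coef !mxE. Qed.

Lemma sqr_conv (k x y : R) : 0 <= k -> k <= 1 ->
  (k * x + (1 - k) * y) ^+ 2 <= k * x ^+ 2 + (1 - k) * y ^+ 2.
Proof.
move=> k0 k1; rewrite -subr_ge0.
rewrite (_ : _ - _ = k * (1 - k) * (x - y) ^+ 2); last by ring.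
by rewrite mulr_ge0 ?sqr_ge0// mulr_ge0 ?subr_ge0//.
Qed.

Lemma gauge_conv v w x (k : R) : 0 <= k -> k <= 1 ->
  gauge (k *: v + (1 - k) *: w) x <= k * gauge v x + (1 - k) * gauge w x.
Proof.
move=> k0 k1; rewrite /gauge !coef_conv.
have := sqr_conv (coef v 0 * x.1 + coef v 1) (coef w 0 * x.1 + coef w 1) k0 k1.
have := sqr_conv (coef v 2 * x.1 + coef v 3 * x.2 + coef v 4)
                 (coef w 2 * x.1 + coef w 3 * x.2 + coef w 4) k0 k1.
move=> h1 h2; apply: le_trans (le_trans _ (lerD h2 h1)) _; last by lra.
by rewrite le_eqVlt; apply/orP; left; apply/eqP; ring.
Qed.

Lemma convex_contains x : convex_set [set v | gauge v x <= 1].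
Proof.
apply/convex_setP => v w k k0 k1 /= gv gw.
apply: le_trans (gauge_conv v w x k0 k1) _.
have k1' : 0 <= 1 - k by rewrite subr_ge0.
have := ler_wpM2l k0 gv; have := ler_wpM2l k1' gw; lra.
Qed.

Lemma coef_pos_conv v w (k : R) : 0 <= k -> k <= 1 ->
  coef_pos v -> coef_pos w -> coef_pos (k *: v + (1 - k) *: w).
Proof.
have pos (a b : R) : 0 <= k -> k <= 1 -> 0 < a -> 0 < b ->
  0 < k * a + (1 - k) * b.
  move=> k0 k1 a0 b0; have [->|kn] := eqVneq k 0.
    by rewrite mul0r add0r subr0 mul1r.
  rewrite ltr_wpDr ?mulr_ge0 ?subr_ge0 ?(ltW b0)// mulr_gt0//.
  by rewrite lt_neqAle eq_sym kn.
by move=> k0 k1 [v0 v3] [w0 w3]; split; rewrite coef_conv; exact: pos.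
Qed.

(** The excess over [m] splits into terms in [k ^+ 2], [k * (1 - k)] and [(1 - k) ^+ 2], and the
    first is already strictly positive. So [w] may have determinant exactly [m], as the optimal
    ellipse does in [optimal_contact]. *)
Lemma coef_det_conv v w (m k : R) : 0 < k -> k <= 1 ->
  coef_pos v -> coef_pos w -> 0 <= m -> m < coef_det v -> m <= coef_det w ->
  m < coef_det (k *: v + (1 - k) *: w).
Proof.
rewrite /coef_det !coef_conv => k0 k1 [].
set p := coef v 0; set r := coef v 3; set p' := coef w 0; set r' := coef w 3.
move=> p0 r0 [p'0 r'0] m0 mv mw.
(* AM-GM *)
have h : 2 * m <= p * r' + p' * r.
  have e0 : 0 <= p * r' + p' * r by rewrite addr_ge0// mulr_ge0// ltW.
  rewrite -(ler_pXn2r (n := 2)) ?nnegrE ?mulr_ge0//.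
  have : m * m <= (p * r) * (p' * r') by rewrite ler_pM// ltW.
  have := sqr_ge0 (p * r' - p' * r); lra.
have k1' : 0 <= 1 - k by rewrite subr_ge0.
have h1 : 0 < k ^+ 2 * (p * r - m) by rewrite mulr_gt0 ?exprn_gt0 ?subr_gt0.
have h2 : 0 <= k * (1 - k) * (p * r' + p' * r - 2 * m).
  by rewrite !mulr_ge0 ?subr_ge0// ltW.
have h3 : 0 <= (1 - k) ^+ 2 * (p' * r' - m).
  by rewrite mulr_ge0 ?sqr_ge0 ?subr_ge0.
by lra.
Qed.

Lemma convex_coef_det (m : R) : 0 <= m ->
  convex_set [set v | coef_pos v /\ m < coef_det v].
Proof.
move=> m0; apply/convex_setP => v w k k0 k1 /= [v0 vm] [w0 wm].
split; first exact: coef_pos_conv.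
have [->|kn] := eqVneq k 0; first by rewrite scale0r add0r subr0 scale1r.
by apply: coef_det_conv => //; [rewrite lt_neqAle eq_sym kn|exact: ltW].
Qed.

Lemma contains_near v w X : contains v X ->
    (forall x, x \in X -> gauge v x = 1 -> gauge w x <= 1) ->
  exists2 k : R, 0 < k <= 1 & contains (k *: w + (1 - k) *: v) X.
Proof.
move=> vX wX.
(* For the induction every smaller step must work too, so that thresholds of different points can be
   combined by a minimum. *)
suff [k0 /andP[k00 k01] kX] : exists2 k0 : R, 0 < k0 <= 1 &
    forall k, 0 < k -> k <= k0 -> contains (k *: w + (1 - k) *: v) X.
  by exists k0; [rewrite k00|exact: kX].
elim: X => [|x X IH] in vX wX *; first by exists 1 => //; rewrite ltr01 lexx.
have [||k0 /andP[k00 k01] kX] := IH.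
- by move=> y yX; apply: vX; rewrite inE yX orbT.
- by move=> y yX; apply: wX; rewrite inE yX orbT.
have vx : gauge v x <= 1 by apply: vX; rewrite mem_head.
have gw : 0 <= gauge w x by rewrite addr_ge0 ?sqr_ge0.
have [vx1|vx1] := eqVneq (gauge v x) 1.
  have wx := wX _ (mem_head _ _) vx1.
  exists k0; first by rewrite k00.
  move=> k kk kk0 y; rewrite inE => /orP[/eqP ->|yX]; last exact: kX.
  have k1 := le_trans kk0 k01.
  by have /convex_setP := @convex_contains x; apply=> //; exact: ltW.
have d0 : 0 < 1 - gauge v x by rewrite subr_gt0 lt_neqAle vx1.
(* It suffices that [k * (gauge w x - gauge v x) <= 1 - gauge v x]; adding 1 in the denominator
   keeps it positive. *)
pose kx := (1 - gauge v x) / (1 - gauge v x + gauge w x).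
have kx0 : 0 < kx by rewrite divr_gt0// ltr_wpDr.
exists (Num.min k0 kx); first by rewrite lt_min k00 kx0 ge_min k01.
move=> k kk; rewrite le_min => /andP[kk0 kkx] y.
rewrite inE => /orP[/eqP ->|yX]; last exact: kX.
have k1 := le_trans kk0 k01.
apply: le_trans (gauge_conv w v x (ltW kk) k1) _.
move: kkx; rewrite ler_pdivlMr; last by rewrite ltr_wpDr.
lra.
Qed.

(** Area is inversely proportional to [coef_det], so the largest determinant means the smallest
    area. *)
Definition optimal v X := forall w, coef_pos w -> contains w X ->
  coef_det w <= coef_det v.

(** A better [w] for the contact points alone would yield, by a small step from [v] towards [w], a
    better ellipse for all of [X]. *)
Lemma optimal_contact v X : coef_pos v -> contains v X -> optimal v X ->
  optimal v [seq x <- X | gauge v x == 1].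
Proof.
move=> v0 vX vopt w w0 wX; rewrite leNgt; apply/negP => vw.
have [x xX gx|k /andP[k0 k1] kX] := contains_near (w := w) vX.
  by apply: wX; rewrite mem_filter gx eqxx.
have det0 : 0 <= coef_det v by case: v0 => ? ?; rewrite mulr_ge0 ?ltW.
have := coef_det_conv k0 k1 w0 v0 det0 vw (lexx _).
by rewrite ltNge vopt//; apply: coef_pos_conv => //; exact: ltW.
Qed.

Lemma optimal_five v X : coef_pos v -> contains v X -> optimal v X ->
  exists Z : seq (R * R), [/\ {subset Z <= X}, (size Z <= 5)%N,
    forall z, z \in Z -> gauge v z = 1 & optimal v Z].
Proof.
move=> v0 vX /(optimal_contact v0 vX) vopt.
pose X' := [seq x <- X | gauge v x == 1].
have det0 : 0 <= coef_det v by case: v0 => ? ?; rewrite mulr_ge0 ?ltW.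
pose C (o : option (R * R)) : set 'rV[R]_5 :=
  (* [None] indexes the determinant condition, so that Helly's theorem applies to a single
     family. *)
  if o is Some x then [set w | gauge w x <= 1]
  else [set w | coef_pos w /\ coef_det v < coef_det w].
have [[w Cw]|noC] := pselect (exists w, forall o,
  o \in None :: map some X' -> C o w).
  have [w0] := Cw None (mem_head _ _).
  rewrite ltNge vopt// => x xX'; apply: (Cw (Some x)).
  by rewrite inE map_f.
have [u uX [u6 Cu]] : exists2 u : seq (option (R * R)),
    {subset u <= None :: map some X'} &
    (size u <= 6)%N /\ ~ exists w, forall o, o \in u -> C o w.
  apply: contrapT => nou; apply: noC; apply: helly.
    by move=> [x|] _; [exact: convex_contains|exact: convex_coef_det].
  by move=> u uX u6; apply: contrapT => Cu; apply: nou; exists u.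
have uX' x : Some x \in u -> x \in X'.
  by move=> /uX; rewrite inE /= => /mapP[y yX [->]].
(* The point conditions alone are all met by [v], so an inconsistent subfamily contains [None]; this
   leaves at most five points. *)
have uN : None \in u.
  apply: contrapT => /negP uN; apply: Cu; exists v => -[x xu|]; last first.
    by rewrite (negbTE uN).
  by have := uX' _ xu; rewrite mem_filter /= => /andP[/eqP ->].
have memZ x : (x \in pmap id u) = (Some x \in u).
  by rewrite mem_pmap map_id.
exists (pmap id u); split.
- by move=> x; rewrite memZ => /uX'; rewrite mem_filter => /andP[].
- rewrite size_pmap -ltnS; apply: leq_trans u6.
  rewrite -(count_predC (fun o : option (R * R) => o) u) -addn1 leq_add2l.
  by rewrite -has_count; apply/hasP; exists None.
- by move=> z; rewrite memZ => /uX'; rewrite mem_filter => /andP[/eqP].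
- move=> w w0 wZ; rewrite leNgt; apply/negP => vw; apply: Cu.
  by exists w => -[x xu|_] //=; apply: wZ; rewrite memZ.
Qed.

(** Cramer's rule recovers an affine function from its values at three non-collinear points. This
    makes the parameter set in [optimal_exists] bounded. *)
Lemma affine_coef_bound (a b c : R * R) : cross a b c != 0 ->
  exists2 M : R, 0 <= M & forall p q s : R,
    (forall x, x \in [:: a; b; c] -> `|p * x.1 + q * x.2 + s| <= 1) ->
  [/\ `|p| <= M, `|q| <= M & `|s| <= M].
Proof.
move=> D0; set D := cross a b c in D0.
pose B :=
  2 * (`|b.1 - a.1| + `|b.2 - a.2| + `|c.1 - a.1| + `|c.2 - a.2|) / `|D|.
have B0 : 0 <= B by rewrite divr_ge0 ?mulr_ge0 ?addr_ge0.
have aB0 : 0 <= B * (`|a.1| + `|a.2|) by rewrite mulr_ge0 ?addr_ge0.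
exists (1 + B + B * (`|a.1| + `|a.2|)) => [|p q s f1];
  first by rewrite !addr_ge0.
set f := fun x : R * R => p * x.1 + q * x.2 + s.
have fa : `|f a| <= 1 by apply: f1; rewrite !inE eqxx.
have fb : `|f b - f a| <= 2.
  by apply: le_trans (ler_normB _ _) _; rewrite lerD// f1// !inE eqxx ?orbT.
have fc : `|f c - f a| <= 2.
  by apply: le_trans (ler_normB _ _) _; rewrite lerD// f1// !inE eqxx ?orbT.
have bound (z e1 e2 : R) : z * D = (f b - f a) * e1 - (f c - f a) * e2 ->
    `|e1| + `|e2| <=
      `|b.1 - a.1| + `|b.2 - a.2| + `|c.1 - a.1| + `|c.2 - a.2| ->
    `|z| <= B.
  move=> zE e12; rewrite ler_pdivlMr ?normr_gt0// -normrM zE.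
  apply: le_trans (ler_normB _ _) _; rewrite !normrM.
  apply: le_trans (_ : 2 * (`|e1| + `|e2|) <= _); last by rewrite ler_pM2l.
  by rewrite mulrDr lerD// ler_wpM2r.
have pB : `|p| <= B.
  apply: (bound _ (c.2 - a.2) (b.2 - a.2)); first by rewrite /f /D /cross; ring.
  have := normr_ge0 (b.1 - a.1); have := normr_ge0 (c.1 - a.1); lra.
have qB : `|q| <= B.
  apply: (bound _ (a.1 - c.1) (a.1 - b.1)); first by rewrite /f /D /cross; ring.
  rewrite (distrC a.1) (distrC a.1).
  have := normr_ge0 (b.2 - a.2); have := normr_ge0 (c.2 - a.2); lra.
have sB : `|s| <= 1 + B * (`|a.1| + `|a.2|).
  rewrite (_ : s = f a - (p * a.1 + q * a.2)); last by rewrite /f; ring.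
  apply: le_trans (ler_normB _ _) _; rewrite lerD//.
  apply: le_trans (ler_normD _ _) _; rewrite !normrM mulrDr.
  by rewrite lerD// ler_wpM2r.
by split; lra.
Qed.

Lemma continuous_coef i : continuous (fun v : 'rV[R]_5 => coef v i).
Proof. exact: coord_continuous. Qed.

Lemma continuous_gauge x : continuous (fun v => gauge v x).
Proof.
have sq (f : 'rV[R]_5 -> R) : continuous f -> continuous (fun v => f v ^+ 2).
  move=> cf v; apply: (@cvg_comp _ _ _ f (fun y : R => y ^+ 2));
    last exact: exprn_continuous.
  exact: cf.
have lin i (y : R) : continuous (fun v => coef v i * y).
  by move=> v; exact: cvgM (@continuous_coef i v) (cvg_cst _).
have add (f g : 'rV[R]_5 -> R) :
    continuous f -> continuous g -> continuous (fun v => f v + g v).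
  by move=> cf cg v; exact: cvgD (cf v) (cg v).
apply: (add (fun v => _) (fun v => _)); apply: sq.
  by apply: (add (fun v => _) (fun v => _));
    [exact: lin|exact: continuous_coef].
apply: (add (fun v => _) (fun v => _)); last exact: continuous_coef.
by apply: (add (fun v => _) (fun v => _)); exact: lin.
Qed.

Lemma optimal_exists X a b c : a \in X -> b \in X -> c \in X ->
    cross a b c != 0 ->
  exists v, [/\ coef_pos v, contains v X & optimal v X].
Proof.
move=> aX bX cX D0.
have [M M0 MP] := affine_coef_bound D0.
(* Weak inequalities make [K] closed; strict positivity returns at the end, because the maximal
   determinant is positive. *)
pose K : set 'rV[R]_5 :=
  [set v | [/\ 0 <= coef v 0, 0 <= coef v 3 & contains v X]].
have KM : K `<=` [set v | forall i, `[- M, M]%classic (v ord0 i)].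
  move=> v [_ _ vX] i /=; rewrite in_itv /= -ler_norml.
  have in_X y : y \in [:: a; b; c] -> y \in X.
    by rewrite !inE => /or3P[] /eqP ->.
  have g1 y : y \in X -> `|coef v 0 * y.1 + 0 * y.2 + coef v 1| <= 1.
    move=> /vX; rewrite /gauge mul0r addr0 => gy.
    rewrite -(ler_pXn2r (n := 2)) ?nnegrE// real_normK ?num_real// expr1n.
    by apply: le_trans gy; rewrite lerDl sqr_ge0.
  have g2 y : y \in X -> `|coef v 2 * y.1 + coef v 3 * y.2 + coef v 4| <= 1.
    move=> /vX; rewrite /gauge => gy.
    rewrite -(ler_pXn2r (n := 2)) ?nnegrE// real_normK ?num_real// expr1n.
    by apply: le_trans gy; rewrite lerDr sqr_ge0.
  have [p0 _ p1] := MP _ _ _ (fun y h => g1 y (in_X y h)).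
  have [p2 p3 p4] := MP _ _ _ (fun y h => g2 y (in_X y h)).
  have -> : v ord0 i = coef v i by rewrite /coef inord_val.
  by case: i => -[|[|[|[|[|//]]]]].
have cK : compact K.
  apply: subclosed_compact KM; last first.
    by apply: (@rV_compact _ _ (fun=> `[- M, M]%classic)) => i;
      exact: segment_compact.
  have clc i : closed [set v : 'rV[R]_5 | 0 <= coef v i].
    apply: (@preimage_closed _ _ (fun v => coef v i) [set y | 0 <= y]);
      last exact: closed_ge.
    by move=> v _; exact: continuous_coef.
  rewrite (_ : K = [set v | 0 <= coef v 0] `&` [set v | 0 <= coef v 3] `&`
     \bigcap_(x in [set` X]) [set v | gauge v x <= 1]).
    apply: closedI; first exact: closedI.
    apply: closed_bigI => x _.
    apply: (@preimage_closed _ _ (fun v => gauge v x) [set y | y <= 1]);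
      last exact: closed_le.
    by move=> v _; exact: continuous_gauge.
  by apply/seteqP; split=> [v [v0 v3 vX]|v [[v0 v3] vX]].
have [N N1 NX] : exists2 N : R, 1 <= N &
    forall x, x \in X -> x.1 ^+ 2 + x.2 ^+ 2 <= N.
  elim: (X) => [|x s [N N1 IH]]; first by exists 1.
  exists (N + (x.1 ^+ 2 + x.2 ^+ 2)).
    by rewrite (le_trans N1)// lerDl addr_ge0 ?sqr_ge0.
  move=> y; rewrite inE => /orP[/eqP ->|/IH yN].
    by rewrite lerDr (le_trans ler01).
  by rewrite (le_trans yN)// lerDl addr_ge0 ?sqr_ge0.
have N0 : 0 < N by exact: lt_le_trans N1.
(* The disk of radius [N] about the origin; it contains [X] since [N <= N ^+ 2]. *)
pose v0 := coef_pack (N^-1) 0 0 N^-1 (0 : R).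
have v0K : K v0.
  split; rewrite ?coef_packE//= ?invr_ge0 ?(ltW N0)// => x /NX xN.
  rewrite /gauge !coef_packE//= mul0r add0r !addr0 !exprMn -mulrDr.
  rewrite exprVn ler_pdivrMl ?exprn_gt0// mulr1 (le_trans xN)//.
  by rewrite expr2 ler_pMr.
have [||v vK vmax] := @EVT_max_rV R 5 coef_det K _ cK; first by exists v0.
  apply: continuous_subspaceT => v;
    exact: cvgM (@continuous_coef 0 v) (@continuous_coef 3 v).
have det0 : 0 < coef_det v.
  apply: lt_le_trans (vmax v0 (mem_set v0K)).
  by rewrite /coef_det !coef_packE//= mulr_gt0 ?invr_gt0.
move: vK; rewrite inE => -[v0' v3' vX]; exists v; split=> //.
  move: det0; rewrite /coef_det; move: v0' v3'.
  rewrite !le_eqVlt => /orP[/eqP <-|v0' /orP[/eqP <-|//]].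
    by rewrite mul0r ltxx.
  by rewrite mulr0 ltxx.
by move=> w [w0 w3] wX; apply: vmax; rewrite inE; split=> //; exact: ltW.
Qed.

Definition ellipse v : set (R * R) := [set x | gauge v x <= 1].

(** Moving [x] away from the centre by a factor [1 + k] multiplies its gauge by [(1 + k) ^+ 2], so
    points outside the ellipse lie arbitrarily close to [x]. *)
Lemma boundary_ellipse v x : coef_pos v -> gauge v x = 1 ->
  boundary (ellipse v) x.
Proof.
move=> [v0 v3] vx; split.
  by apply: subset_closure; rewrite /ellipse /= vx.
rewrite /interior /= => nx.
pose c1 := - coef v 1 / coef v 0.
pose c2 := - (coef v 2 * c1 + coef v 4) / coef v 3.
(* h moves x away from the centre (c1, c2) of the ellipse *)
pose h (k : R) : R * R := (x.1 + k * (x.1 - c1), x.2 + k * (x.2 - c2)).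
have ca (y d : R) : y + k * d @[k --> (0 : R)] --> y + 0 * d.
  by apply: cvgD; [exact: cvg_cst|apply: cvgM; [exact: cvg_id|exact: cvg_cst]].
have ch : h k @[k --> (0 : R)] --> x.
  rewrite (_ : x = h 0); first exact: cvg_pair (ca _ _) (ca _ _).
  by rewrite /h !mul0r !addr0; case: (x).
have /nbhs_ballP[e /= e0 he] := ch _ nx.
have : ellipse v (h (e / 2)).
  apply: he; rewrite /ball /= sub0r normrN gtr0_norm ?divr_gt0//.
  by rewrite gtr_pMr// invf_lt1 ?ltr1n.
have -> : ellipse v (h (e / 2)) = ((1 + e / 2) ^+ 2 * gauge v x <= 1) :> Prop.
  rewrite /ellipse /gauge /=; congr (is_true (_ <= _)).
  by rewrite /c2 /c1; field; rewrite !gt_eqF.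
by rewrite vx mulr1 leNgt exprn_egt1// ltrDl divr_gt0.
Qed.

Lemma elliptical_disk_ellipse v : coef_pos v -> elliptical_disk (ellipse v).
Proof. by move=> [v0 v3]; exact: elliptical_disk_triangular. Qed.

Lemma min_area_ellipse v Z : coef_pos v -> contains v Z -> optimal v Z ->
  min_area_elliptical_disk (ellipse v) [set` Z].
Proof.
move=> v0 vZ vopt; split; [exact: elliptical_disk_ellipse|exact: vZ|].
move=> E' /elliptical_diskP[p [s [q [r [t [p0 r0 ->]]]]]] ZE'.
have area_v : area (ellipse v) = area (triangular_ellipse (coef v 0) (coef v 1)
  (coef v 2) (coef v 3) (coef v 4)) by [].
case: (v0) => p0' r0'; rewrite area_v !area_triangular_ellipse//.
apply: lee_wpmul2r.
  by apply: integral_ge0 => x _; rewrite lee_fin mulr_ge0 ?sqrtr_ge0.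
rewrite lee_fin lef_pV2 ?posrE ?mulr_gt0//.
have := vopt (coef_pack p s q r t);
  rewrite /coef_det /coef_pos /contains /gauge.
by rewrite !coef_packE//; apply; [split|move=> x; exact: ZE'].
Qed.

End LoewnerEllipse.

Theorem theorem3 (R : realType) :
  finite_conjecture R -> is_lambda (unit_disk R) 3 (golden_ratio R).
Proof.
move=> conj; have phi0 : 0 < golden_ratio R.
  have /andP[phi1 _] := golden_ratio_bounds R.
  by apply: lt_trans phi1; rewrite divr_gt0.
split; last first.
  move=> l [l0 lX]; apply: pentagon_width => //; apply: lX (@pentagon_Ts R).
  exact: finite_seq.
split=> // _ /finite_seqP[X ->] XT.
have [[a [b [c [aX bX cX abc]]]]|collin] := pselect (exists a b c : R * R,
    [/\ a \in X, b \in X, c \in X & cross a b c != 0]); last first.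
  (* A collinear [X] is met by a line directly, without the conjecture. *)
  apply: property_T_collinear => // a b c aX bX cX.
  by apply/eqP; apply: contrapT => /negP abc; apply: collin; exists a, b, c.
have [v [v0 vX vopt]] := optimal_exists aX bX cX abc.
have [Z [ZX Z5 vZ Zopt]] := optimal_five v0 vX vopt.
apply: property_T_subset (conj (ellipse v) [set` Z] _ _ _ _).
(* [x] is in [R_set] of [Z] because adding [x] to [Z] gives a subset of [X]. *)
- move=> x Xx; split; last exact: vX.
  by apply: property_Ts_subset XT => y [->|/ZX].
- exact: elliptical_disk_ellipse.
- by move=> z Zz; exact: boundary_ellipse (vZ _ Zz).
- exact: card_le_size.
- by apply: min_area_ellipse => // z /vZ ->.
Qed.
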